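(* Minimum Sum Coloring with Bundles can be solved in polynomial time on instances in which $G$ is bipartite and $|\mathcal{B}|\le 2$ (with arbitrary positive integer weights).
   Context: Minimum Sum Coloring with Bundles: given an undirected graph $G=(V,E)$, a family $\mathcal{B}=\{B_1,\dots,B_\ell\}$ of non-empty subsets of $V$ (bundles) such that every vertex lies in at least one bundle, a weight function $w\colon\mathcal{B}\to\mathbb{Z}_{>0}$ and a positive integer $C$, decide whether there exists a proper coloring $c\colon V\to\mathbb{Z}_{>0}$ (i.e. $c(u)\ne c(v)$ for every edge $uv$) with $\sum_{j=1}^{\ell} w(B_j)\max\{c(v)\mid v\in B_j\}\le C$. Bundles need not be disjoint. *)

(* Defs.v *)
From HB Require Import structures.
From mathcomp Require Import all_boot all_order all_algebra.

Set Implicit Arguments.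
Unset Strict Implicit.
Unset Printing Implicit Defensive.

Import GRing.Theory.

(* Deterministic multi-tape Turing machines over the input alphabet Sigma.
   A tape is infinite in both directions: [tleft] lists the cells to the left of
   the head, nearest first, [tright] those to the right, and every cell beyond
   the two lists is blank. *)

Inductive move := MoveLeft | Stay | MoveRight.

Record tape (Gamma : Type) :=
  Tape { tleft : seq Gamma; tcur : Gamma; tright : seq Gamma }.

Definition tape_step (Gamma : Type) (blank : Gamma) (t : tape Gamma)
    (a : Gamma * move) : tape Gamma :=
  match a.2 with
  | MoveLeft => Tape (behead (tleft t)) (head blank (tleft t)) (a.1 :: tright t)
  | Stay => Tape (tleft t) a.1 (tright t)
  | MoveRight => Tape (a.1 :: tleft t) (head blank (tright t)) (behead (tright t))
  end.

(* There are [ntapes.+1] tapes, tape [ord0] carrying the input.  [verdict q] is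
   [Some true] on accepting states, [Some false] on rejecting states, and [None]
   on states from which the computation goes on. *)
Record turing_machine (Sigma : Type) := TuringMachine {
  state : finType;
  alphabet : finType;
  ntapes : nat;
  blank : alphabet;
  inj_input : Sigma -> alphabet;
  inj_input_inj : injective inj_input;
  inj_input_blank : forall a, inj_input a != blank;
  start : state;
  verdict : state -> option bool;
  delta : state -> {ffun 'I_ntapes.+1 -> alphabet} ->
          state * ('I_ntapes.+1 -> alphabet * move)
}.

Section Run.
Variables (Sigma : Type) (M : turing_machine Sigma).

Definition config : Type :=
  (state M * {ffun 'I_(ntapes M).+1 -> tape (alphabet M)})%type.

Definition init_config (w : seq Sigma) : config :=
  let u := [seq inj_input M a | a <- w] in
  (start M,
   [ffun i => if i == ord0 then Tape [::] (head (blank M) u) (behead u)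
              else Tape [::] (blank M) [::]]).

Definition step (c : config) : config :=
  if verdict c.1 is Some _ then c else
  let: (q, act) := delta c.1 [ffun i => tcur (c.2 i)] in
  (q, [ffun i => tape_step (blank M) (c.2 i) (act i)]).

Definition halts_within (w : seq Sigma) (t : nat) (b : bool) : Prop :=
  verdict (iter t step (init_config w)).1 = Some b.

End Run.

(* The decision problem [yes] on inputs [x : I], presented to the machine as the
   word [enc x], is solvable in polynomial time on the inputs satisfying [D].
   The machine is unconstrained on the inputs outside [D]. *)
Definition polytime_solvable_on (Sigma I : Type) (enc : I -> seq Sigma)
    (D yes : I -> Prop) : Prop :=
  exists (M : turing_machine Sigma) (p : {poly nat}),
    forall x : I, D x ->
      exists b : bool,
        halts_within M (enc x) (p.[size (enc x)])%R b /\ (b <-> yes x).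

(* The bundles form an indexed family; repeated bundles are allowed. *)
Record instance := Instance {
  nv : nat;
  edge : rel 'I_nv;
  edge_sym : symmetric edge;
  edge_irrefl : irreflexive edge;
  nb : nat;
  bundle : 'I_nb -> {set 'I_nv};
  bundle_neq0 : forall j, bundle j != set0;
  bundle_cover : forall v, exists j, v \in bundle j;
  weight : 'I_nb -> nat;
  weight_gt0 : forall j, 0 < weight j;
  bound : nat;
  bound_gt0 : 0 < bound
}.

Definition proper_coloring (n : nat) (e : rel 'I_n) (c : 'I_n -> nat) : Prop :=
  (forall v, 0 < c v) /\ (forall u v, e u v -> c u <> c v).

Definition bundle_cost (I : instance) (c : 'I_(nv I) -> nat) : nat :=
  \sum_(j < nb I) weight j * \max_(v in bundle j) c v.

Definition msc_bundles (I : instance) : Prop :=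
  exists c : 'I_(nv I) -> nat,
    proper_coloring (@edge I) c /\ bundle_cost c <= bound I.

Definition bipartite (n : nat) (e : rel 'I_n) : Prop :=
  exists A : {set 'I_n}, forall u v, e u v -> (u \in A) != (v \in A).

(* Instances are written over the alphabet {0, 1, #}, with # coded by [None]:
     row_1 # ... row_n # #  B_1 # w_1 # ... B_l # w_l # #  C
   where row_i are the rows of the adjacency matrix, B_j is given by its
   characteristic vector, and w_j, C are in binary, least significant bit
   first. *)
Definition symbol : Type := option bool.

Definition binary (m : nat) : seq bool :=
  mkseq (fun i => odd (m %/ 2 ^ i)) (trunc_log 2 m).+1.

Definition field (s : seq bool) : seq symbol := rcons (map Some s) None.

Definition encode (I : instance) : seq symbol :=
  flatten [seq field [seq edge u v | v <- enum 'I_(nv I)] | u <- enum 'I_(nv I)]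
  ++ None ::
  flatten [seq field [seq v \in bundle j | v <- enum 'I_(nv I)]
               ++ field (binary (weight j)) | j <- enum 'I_(nb I)]
  ++ None ::
  map Some (binary (bound I)).

(* Main.v *)
(** Write [M1], [M2] for the largest colors on the bundles [B1], [B2] (a missing
    bundle is empty and has weight 0).  As G is bipartite, [(2, 2)] is always
    achievable; [(1, 1)] iff G has no edge; [(1, 3)] iff [B1] is independent
    (color [B1] with 1 and the two sides of the rest with 2 and 3); [(1, 2)] iff
    no vertex is reached from [B1] by both an even and an odd walk.  Every coloring
    is dominated by one of these or their mirror images, so an instance is
    positive iff one achievable pair [(a, b)] has [a * w1 + b * w2 <= C].

    The walk parities are the least fixpoint of [S = B :|: N(T)], [T = N(S)],
    reached after at most [2n] sweeps over the adjacency matrix.  The comparison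
    with [C] is one left-to-right pass over the binary numbers, least significant
    bit first, whose bounded borrow fits into the finite control. *)

From HB Require Import structures.
From mathcomp Require Import all_boot all_order all_algebra zify.
Require Import Defs.

Set Implicit Arguments.
Unset Strict Implicit.
Unset Printing Implicit Defensive.

(** * The machine *)

(* Membership of a vertex in [B], in [S] (even walks) and in [T] (odd walks). *)
Definition flags3 : Type := (bool * bool * bool)%type.
Definition status : Type := (flags3 * flags3)%type.
Definition letter : Type := (symbol + status)%type.
Definition cell : Type := option letter.

Definition or3 (a b : flags3) : flags3 :=
  (a.1.1 || b.1.1, a.1.2 || b.1.2, a.2 || b.2).
Definition or_status (a b : status) : status := (or3 a.1 b.1, or3 a.2 b.2).
Definition zero_status : status := ((false, false, false), (false, false, false)).

(** [acc] is the union of the flags of the neighbors: membership in [B] is kept, [S] becomes [B] or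
    a neighbor in [T], and [T] becomes a neighbor in [S]. *)
Definition next3 (old acc : flags3) : flags3 :=
  (old.1.1, old.1.1 || acc.2, acc.1.2).
Definition next_status (old acc : status) : status :=
  (next3 old.1 acc.1, next3 old.2 acc.2).

(* For one bundle: some edge lies inside [B]; some vertex lies in both [S] and [T]. *)
Definition alarm : Type := (bool * bool)%type.
(** The second alarm tests the flags as updated by [next3], so a sweep reports the clashes of the
    layer that it produces. *)
Definition alarm3 (f : alarm) (old acc : flags3) : alarm :=
  (f.1 || old.1.1 && acc.1.1, f.2 || (old.1.1 || acc.2) && acc.1.2).
Definition alarms (f : alarm * alarm) (old acc : status) : alarm * alarm :=
  (alarm3 f.1 old.1 acc.1, alarm3 f.2 old.2 acc.2).
Definition no_alarm : alarm * alarm := ((false, false), (false, false)).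

(** The candidate pairs use multipliers up to 3 only, and debts stay at most 6; so all comparisons
    run in parallel in the finite control. *)
Definition borrows : Type := {ffun 'I_4 * 'I_4 -> 'I_8}.
(* [r (a, b)] is the debt left of [a * w1 + b * w2 - C] after the bits read so far;
   the [+ 1] makes the halving round up, and the debt never exceeds [a + b]. *)
Definition borrow_step (r : borrows) (c x y : bool) : borrows :=
  [ffun ab : 'I_4 * 'I_4 =>
     inord ((r ab + ab.1 * x + ab.2 * y + 1 - c) %/ 2)].
Definition fits (r : borrows) (a b : nat) : bool :=
  r (inord a, inord b) == ord0.

(* An edge was seen; the debts; the union of the statuses of the neighbors met so far
   in the current row; the alarms of the current sweep. *)
Definition regs : Type := (bool * borrows * status * (alarm * alarm))%type.

(* [Rew s _] brings the head of tape [site_tape s] back to its first cell and goes on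
   with [site_next s]. *)
Inductive site := Site1 | Site2 | Site3 | Site4 | SiteX | SiteXY | SiteY | SiteI | SiteRow.
Inductive field_no := Fld1 | Fld2 | Fld3 | Fld4 | FldEnd.
(** The flag of [ParseM] and [ParseB] is set at the start of a field. That of [Rew] is set until the
    first move, since the head may start on the blank beyond the word. That of [Map] chooses between
    [merge] and [copy]. *)
Inductive label :=
  | ParseM of bool | ParseB of bool & field_no | Rew of site & bool
  | Arith | Map of bool | Pass | RowStart | Row | Halt of bool.

(** * Finiteness of the control states *)

Definition site_code (s : site) : 'I_9 :=
  match s with
  | Site1 => inord 0 | Site2 => inord 1 | Site3 => inord 2 | Site4 => inord 3
  | SiteX => inord 4 | SiteXY => inord 5 | SiteY => inord 6 | SiteI => inord 7
  | SiteRow => inord 8 end.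
Definition site_decode (k : 'I_9) : site :=
  nth Site1 [:: Site1; Site2; Site3; Site4; SiteX; SiteXY; SiteY; SiteI; SiteRow] k.
Lemma site_codeK : cancel site_code site_decode.
Proof. by case; rewrite /site_decode inordK. Qed.
HB.instance Definition _ := Finite.copy site (can_type site_codeK).

Definition field_code (s : field_no) : 'I_5 :=
  match s with
  | Fld1 => inord 0 | Fld2 => inord 1 | Fld3 => inord 2 | Fld4 => inord 3
  | FldEnd => inord 4 end.
Definition field_decode (k : 'I_5) : field_no :=
  nth Fld1 [:: Fld1; Fld2; Fld3; Fld4; FldEnd] k.
Lemma field_codeK : cancel field_code field_decode.
Proof. by case; rewrite /field_decode inordK. Qed.
HB.instance Definition _ := Finite.copy field_no (can_type field_codeK).

Definition label_rep : Type :=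
  (bool + (bool * field_no) + (site * bool) + (bool + bool + 'I_4))%type.
Definition label_code (p : label) : label_rep :=
  match p with
  | ParseM b => inl (inl (inl b))
  | ParseB b k => inl (inl (inr (b, k)))
  | Rew s b => inl (inr (s, b))
  | Map b => inr (inl (inl b))
  | Halt b => inr (inl (inr b))
  | Arith => inr (inr (inord 0)) | Pass => inr (inr (inord 1))
  | RowStart => inr (inr (inord 2)) | Row => inr (inr (inord 3))
  end.
Definition label_decode (x : label_rep) : label :=
  match x with
  | inl (inl (inl b)) => ParseM b
  | inl (inl (inr (b, k))) => ParseB b k
  | inl (inr (s, b)) => Rew s b
  | inr (inl (inl b)) => Map b
  | inr (inl (inr b)) => Halt b
  | inr (inr k) => nth Arith [:: Arith; Pass; RowStart; Row] k
  end.
Lemma label_codeK : cancel label_code label_decode.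
Proof. by case => //=; rewrite inordK. Qed.
HB.instance Definition _ := Finite.copy label (can_type label_codeK).

(** * Transition rules *)

Definition field_tape (k : field_no) : nat :=
  match k with Fld1 => 1 | Fld2 => 2 | Fld3 => 3 | _ => 4 end.
Definition next_field (k : field_no) : field_no :=
  match k with Fld1 => Fld2 | Fld2 => Fld3 | Fld3 => Fld4 | _ => FldEnd end.

Definition site_tape (s : site) : nat :=
  match s with
  | Site1 => 1 | Site2 => 2 | Site3 => 3 | Site4 => 4
  | SiteX => 1 | SiteXY => 3 | SiteY => 3 | SiteI => 0 | SiteRow => 1 end.
Definition site_next (s : site) : label :=
  match s with
  | Site1 => Rew Site2 true | Site2 => Rew Site3 true | Site3 => Rew Site4 true
  | Site4 => Arith | SiteX => Rew SiteXY true | SiteXY => Map false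
  | SiteY => Rew SiteI true | SiteI => Pass | SiteRow => Row end.

Definition cstate : Type := (label * regs)%type.
Definition cstep : Type := (cstate * (nat -> cell * move))%type.

Definition bit_of (x : cell) : bool := if x is Some (inl (Some b)) then b else false.
Definition status_of (x : cell) : status := if x is Some (inr s) then s else zero_status.
Definition bit_status (x y : bool) : status := ((x, false, false), (y, false, false)).

(** A tape that [l] does not mention rewrites the symbol it scans and stays. *)
Definition acts (g : seq cell) (l : seq (nat * (cell * move))) (i : nat) : cell * move :=
  foldr (fun p d => if i == p.1 then p.2 else d) (nth None g i, Stay) l.

Definition answer (e : bool) (r : borrows) (f : alarm * alarm) : bool :=
  [|| ~~ e && fits r 1 1, fits r 2 2, ~~ f.1.1 && fits r 1 3,
      ~~ f.1.2 && fits r 1 2, ~~ f.2.1 && fits r 3 1 | ~~ f.2.2 && fits r 2 1].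

(** [Map] writes one letter on both tapes 1 and 3: [merge] packs the two characteristic vectors into
    initial statuses, a blank counting as 0 for a missing second bundle; [copy] brings the updated
    statuses of tape 3 back to tape 1. *)
Definition merge (x y : cell) : letter := inr (bit_status (bit_of x) (bit_of y)).
Definition copy (x y : cell) : letter := odflt (inl None) y.

(* Tapes: 0 the input, 1 and 3 the bundles and later the vertex statuses (1 read
   along the columns, 3 updated along the rows), 2 and 4 the weights, 5 a unary
   counter of the sweeps left, one per letter of the adjacency matrix.  An empty
   field ([fresh] on a separator) marks the end of a section of the input. *)
Definition control (s : cstate) (g : seq cell) : cstep :=
  let: (p, rg) := s in
  let: (e, r, a, f) := rg in
  let rd := nth None g in
  let go l := acts g l in
  let fwd i := (i, (rd i, MoveRight)) in
  let adv i := (i, (rd i, if rd i is Some _ then MoveRight else Stay)) in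
  let mark := (5, (Some (inl None), MoveRight)) in
  let unmark := (5, (None, MoveLeft)) in
  match p with
  | ParseM fresh =>
    match rd 0 with
    | Some (inl (Some b)) => ((ParseM false, (e || b, r, a, f)), go [:: fwd 0; mark])
    | Some (inl None) =>
      if fresh then ((ParseB true Fld1, rg), go [:: fwd 0])
      else ((ParseM true, rg), go [:: fwd 0; mark])
    | _ => ((Halt false, rg), go [::])
    end
  | ParseB fresh k =>
    match rd 0 with
    | Some (inl (Some b)) =>
      ((ParseB false k, rg),
       go [:: fwd 0; (field_tape k, (Some (inl (Some b)), MoveRight))])
    | Some (inl None) =>
      if fresh then ((Rew Site1 true, rg), go [:: fwd 0; unmark])
      else ((ParseB true (next_field k), rg), go [:: fwd 0])
    | _ => ((Halt false, rg), go [::])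
    end
  | Rew s init =>
    let j := site_tape s in
    if init || (rd j : bool) then ((Rew s false, rg), go [:: (j, (rd j, MoveLeft))])
    else ((site_next s, rg), go [:: fwd j])
  | Arith =>
    if [|| rd 0 : bool, rd 2 : bool | rd 4 : bool] then
      ((Arith, (e, borrow_step r (bit_of (rd 0)) (bit_of (rd 2)) (bit_of (rd 4)), a, f)),
       go [:: adv 0; adv 2; adv 4])
    else ((Map true, rg), go [::])
  | Map b =>
    if rd 1 is Some _ then
      let z := Some ((if b then merge else copy) (rd 1) (rd 3)) in
      ((Map b, rg), go [:: (1, (z, MoveRight)); (3, (z, MoveRight))])
    else ((Rew SiteY true, rg), go [::])
  | Pass =>
    if rd 5 is Some _ then ((RowStart, (e, r, a, no_alarm)), go [:: unmark])
    else ((Halt (answer e r f), rg), go [::])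
  | RowStart =>
    if rd 0 is Some (inl (Some _)) then ((Rew SiteRow true, (e, r, zero_status, f)), go [::])
    else ((Rew SiteX true, rg), go [::])
  | Row =>
    if rd 0 is Some (inl (Some b)) then
      ((Row, (e, r, if b then or_status a (status_of (rd 1)) else a, f)),
       go [:: fwd 0; fwd 1])
    else
      let old := status_of (rd 3) in
      ((RowStart, (e, r, a, alarms f old a)),
       go [:: fwd 0; (3, (Some (inr (next_status old a)), MoveRight))])
  | Halt b => ((Halt b, rg), go [::])
  end.

Definition inj_symbol (x : symbol) : cell := Some (inl x).
Lemma inj_symbol_inj : injective inj_symbol.
Proof. by move=> x y []. Qed.
Lemma inj_symbol_blank (x : symbol) : inj_symbol x != None.
Proof. by []. Qed.

Definition regs0 : regs := (false, [ffun=> ord0], zero_status, no_alarm).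

Definition verdict_of (s : cstate) : option bool :=
  if s.1 is Halt b then Some b else None.

Definition machine : turing_machine symbol :=
  @TuringMachine symbol cstate cell 5 None inj_symbol inj_symbol_inj
    inj_symbol_blank (ParseM true, regs0) verdict_of
    (fun s g => let: (s', a) := control s [seq g i | i <- enum 'I_6] in
                (s', fun i : 'I_6 => a i)).

(** * Runs on tapes without trailing blanks *)

(* Moving left from the blank beyond a tape's content stores a spurious blank on its
   right; trimming restores Leibniz equality between equivalent tapes. *)
Definition pcons (a : cell) (l : seq cell) : seq cell :=
  match a, l with None, [::] => [::] | _, _ => a :: l end.
Definition trim (l : seq cell) : seq cell := foldr pcons [::] l.
Definition trim_tape (t : tape cell) : tape cell :=
  Tape (trim (tleft t)) (tcur t) (trim (tright t)).

Definition move_tape (t : tape cell) (a : cell * move) : tape cell :=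
  match a.2 with
  | MoveLeft => Tape (behead (tleft t)) (head None (tleft t)) (pcons a.1 (tright t))
  | Stay => Tape (tleft t) a.1 (tright t)
  | MoveRight => Tape (pcons a.1 (tleft t)) (head None (tright t)) (behead (tright t))
  end.

Lemma trim_cons (l : seq cell) : trim (behead l) = behead (trim l) /\ head None (trim l) = head None l.
Proof. by case: l => [|[x|] l] //=; case: (trim l). Qed.

Lemma trim_tape_step (t : tape cell) (a : cell * move) :
  trim_tape (tape_step None t a) = move_tape (trim_tape t) a.
Proof.
case: t => l c r; case: a => x [] //=; rewrite /trim_tape /tape_step /move_tape /=.
- by case: (trim_cons l) => -> ->.
- by case: (trim_cons r) => -> ->.
Qed.

Definition tapes : Type := {ffun 'I_6 -> tape cell}.
Definition mconfig : Type := (cstate * tapes)%type.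

Definition mstep (c : mconfig) : mconfig :=
  if verdict_of c.1 is Some _ then c else
  let: (q, act) := control c.1 [seq tcur (c.2 i) | i <- enum 'I_6] in
  (q, [ffun i : 'I_6 => move_tape (c.2 i) (act i)]).

Definition trim_config (c : config machine) : mconfig :=
  (c.1, [ffun i : 'I_6 => trim_tape (c.2 i)]).

(** Trimming keeps the scanned symbols, so the control takes the same action; runs may thus be
    studied through [mstep]. *)
Lemma trim_step (c : config machine) : trim_config (step c) = mstep (trim_config c).
Proof.
rewrite /trim_config /step /mstep /=; case: (verdict_of c.1) => [?|] //=.
set g1 := [seq _ | i <- enum 'I_6]; set g2 := [seq _ | i <- enum 'I_6].
have -> : g1 = g2 by apply: eq_map => i; rewrite !ffunE.
case: (control c.1 g2) => q a /=; congr (_, _).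
by apply/ffunP => i; rewrite !ffunE trim_tape_step.
Qed.

Lemma trim_iter (c : config machine) k :
  trim_config (iter k (@step _ machine) c) = iter k mstep (trim_config c).
Proof. by elim: k => //= k <-; rewrite trim_step. Qed.

Definition reach (n : nat) (c c' : mconfig) : Prop :=
  exists2 k, k <= n & iter k mstep c = c'.

Lemma reach0 n c : reach n c c.
Proof. by exists 0. Qed.
Lemma reachS n c c' : reach n (mstep c) c' -> reach n.+1 c c'.
Proof. by case=> k kn E; exists k.+1 => //; rewrite iterSr. Qed.
Lemma reach_trans n1 n2 n c1 c2 c3 :
  reach n1 c1 c2 -> reach n2 c2 c3 -> n1 + n2 <= n -> reach n c1 c3.
Proof.
case=> k1 h1 <- [k2 h2 <-] h; exists (k2 + k1); first lia.
by rewrite iterD.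
Qed.
Lemma reach_cat n1 n2 c1 c2 c3 :
  reach n1 c1 c2 -> reach n2 c2 c3 -> reach (n1 + n2) c1 c3.
Proof. by move=> h1 h2; apply: reach_trans h1 h2 (leqnn _). Qed.
Lemma reach_le n m c c' : reach n c c' -> n <= m -> reach m c c'.
Proof. by case=> k h E nm; exists k => //; exact: leq_trans nm. Qed.

Lemma reach_eq n c1 c2 d1 d2 : c1 = c2 -> d1 = d2 -> reach n c1 d1 -> reach n c2 d2.
Proof. by move=> -> ->. Qed.

Lemma iter_halt k (c : mconfig) b : verdict_of c.1 = Some b -> iter k mstep c = c.
Proof. by move=> E; elim: k => //= k ->; rewrite /mstep E. Qed.

(** * Symbolic execution on explicit tapes, and rewinding *)

Definition mk6 (t0 t1 t2 t3 t4 t5 : tape cell) : tapes :=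
  [ffun i : 'I_6 => nth t0 [:: t0; t1; t2; t3; t4; t5] i].

Definition set_tape (t : tapes) (j : nat) (v : tape cell) : tapes :=
  [ffun i : 'I_6 => if val i == j then v else t i].

(** With six explicit tapes a step becomes a computation; the side condition on [p] also
    computes. *)
Lemma mstepE p rg t0 t1 t2 t3 t4 t5 : (if p is Halt _ then false else true) ->
  mstep ((p, rg), mk6 t0 t1 t2 t3 t4 t5) =
  let: (q, a) := control (p, rg)
    [:: tcur t0; tcur t1; tcur t2; tcur t3; tcur t4; tcur t5] in
  (q, mk6 (move_tape t0 (a 0)) (move_tape t1 (a 1)) (move_tape t2 (a 2))
          (move_tape t3 (a 3)) (move_tape t4 (a 4)) (move_tape t5 (a 5))).
Proof.
move=> hp; rewrite /mstep.
have -> : verdict_of (p, rg, mk6 t0 t1 t2 t3 t4 t5).1 = None by case: p hp.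
have -> : [seq tcur ((p, rg, mk6 t0 t1 t2 t3 t4 t5).2 i) | i <- enum 'I_6] =
          [:: tcur t0; tcur t1; tcur t2; tcur t3; tcur t4; tcur t5].
  by rewrite !enum_ordSl enum_ord0 /= !ffunE.
rewrite [(_, _).1]/=; case: (control _ _) => q a; congr (_, _).
by apply/ffunP => -[[|[|[|[|[|[|//]]]]]] hi]; rewrite !ffunE /=.
Qed.

Lemma set_tape_mk6 t0 t1 t2 t3 t4 t5 j v :
  set_tape (mk6 t0 t1 t2 t3 t4 t5) j v =
  mk6 (if 0 == j then v else t0) (if 1 == j then v else t1)
      (if 2 == j then v else t2) (if 3 == j then v else t3)
      (if 4 == j then v else t4) (if 5 == j then v else t5).
Proof. by apply/ffunP => -[[|[|[|[|[|[|//]]]]]] hi]; rewrite !ffunE /= ?ffunE. Qed.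

Notation first_cell r := (head (None : cell) (map Some r)).
(* The left part is listed from the head outwards. *)
Definition word (l r : seq letter) : tape cell :=
  Tape (map Some l) (first_cell r) (behead (map Some r)).
(** The tape [word l r] after one move to the left. For empty [l] the head falls on the blank before
    the first cell, where a rewind turns back. *)
Definition left_of (l r : seq letter) : tape cell :=
  if l is x :: l' then word l' (x :: r) else Tape [::] None (map Some r).

Lemma move_same t : move_tape t (tcur t, Stay) = t.
Proof. by case: t. Qed.

Lemma mstep_rew s init rg (t : tapes) :
  mstep ((Rew s init, rg), t) =
  let j := inord (site_tape s) : 'I_6 in
  if init || (tcur (t j) : bool) then
    ((Rew s false, rg), set_tape t (site_tape s) (move_tape (t j) (tcur (t j), MoveLeft)))
  else ((site_next s, rg), set_tape t (site_tape s) (move_tape (t j) (tcur (t j), MoveRight))).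
Proof.
case: rg => [[[e r] a] f]; rewrite /mstep /=.
have sj : site_tape s < 6 by case: s.
set j := inord _; have vj : val j = site_tape s by rewrite /= inordK.
have rd (i : 'I_6) : nth None [seq tcur (t k) | k <- enum 'I_6] i = tcur (t i).
  by rewrite (nth_map ord0) ?size_enum_ord // nth_ord_enum.
rewrite -vj rd; case: ifP => _; congr (_, _); apply/ffunP => i;
  rewrite !ffunE /acts /=; case: eqP => [E|_]; rewrite ?rd ?move_same //;
  by rewrite (_ : i = j) //; apply: val_inj.
Qed.

Lemma left_word l r : move_tape (word l r) (first_cell r, MoveLeft) = left_of l r.
Proof.
by case: l => [|x l]; case: r => [|y r].
Qed.

Lemma set_tape_twice t j v w : set_tape (set_tape t j v) j w = set_tape t j w.
Proof. by apply/ffunP => i; rewrite !ffunE; case: eqP. Qed.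

(** One step per letter of [l], and a last one to the right from the blank. That blank leaves no
    trace, as [pcons] drops it. The tape is a variable one, so the lemma serves every site. *)
Lemma rewind_left s rg (t : tapes) l r :
  reach (size l).+1 ((Rew s false, rg), set_tape t (site_tape s) (left_of l r))
    ((site_next s, rg), set_tape t (site_tape s) (word [::] (catrev l r))).
Proof.
have sj : site_tape s < 6 by case: s.
have E v : set_tape t (site_tape s) v (inord (site_tape s)) = v.
  by rewrite ffunE /= inordK ?eqxx.
elim: l r => [|x l IH] r.
  apply: reachS; rewrite mstep_rew /= E /= set_tape_twice; case: r => [|y r]; exact: reach0.
by apply: reachS; rewrite mstep_rew /= E /= set_tape_twice (left_word _ (x :: r)); apply: IH.
Qed.

Lemma rewind s rg (t : tapes) l r : t (inord (site_tape s)) = word l r ->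
  reach (size l).+2 ((Rew s true, rg), t)
    ((site_next s, rg), set_tape t (site_tape s) (word [::] (catrev l r))).
Proof.
by move=> E; apply: reachS; rewrite mstep_rew /= E /= left_word; apply: rewind_left.
Qed.

(** * The loops of the machine *)

Fixpoint zipwith (g : cell -> cell -> letter) (xs ys : seq letter) : seq letter :=
  if xs is x :: xs' then g (Some x) (first_cell ys) :: zipwith g xs' (behead ys)
  else [::].

Lemma map_loop b rg i w v k l l' xs ys : size ys <= size xs ->
  let zs := zipwith (if b then merge else copy) xs ys in
  reach (size xs).+1
    ((Map b, rg), mk6 i (word l xs) w (word l' ys) v k)
    ((Rew SiteY true, rg), mk6 i (word (catrev zs l) [::]) w (word (catrev zs l') [::]) v k).
Proof.
case: rg => [[[e r] a] f].
elim: xs ys l l' => [|x xs IH] [|y ys] l l' //= h.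
- by apply: reachS; rewrite mstepE //= !move_same; apply: reach0.
- apply: reachS; rewrite mstepE //= !move_same.
  exact: (IH [::] (_ :: _) (_ :: _)).
- apply: reachS; rewrite mstepE //= !move_same.
  exact: (IH ys (_ :: _) (_ :: _)).
Qed.

(** * Comparison of binary numbers *)

Definition bits (s : seq bool) : seq letter := [seq inl (Some b) | b <- s].
Definition value (s : seq bool) : nat := foldr (fun (b : bool) v => b + v.*2) 0 s.

Lemma value_split s : value s = (ohead s == Some true) + (value (behead s)).*2.
Proof. by case: s => [|[] s]. Qed.

Definition admissible (r : borrows) := forall ab, r ab <= ab.1 + ab.2.

(** A debt of at most [a + b] gives a numerator of at most [2 (a + b) + 1], whose half is again at
    most [a + b], hence at most 6: [inord] truncates nothing. *)
Lemma borrow_stepE r c x y ab : admissible r ->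
  borrow_step r c x y ab = (r ab + ab.1 * x + ab.2 * y + 1 - c) %/ 2 :> nat.
Proof.
move=> /(_ ab) hr; rewrite ffunE inordK //; move: hr; case: ab => a b /=.
by have := ltn_ord a; have := ltn_ord b; case: c x y => [] [] []; rewrite /= ?muln1 ?muln0; lia.
Qed.

Lemma borrow_step_admissible r c x y : admissible r -> admissible (borrow_step r c x y).
Proof.
move=> hr ab; rewrite borrow_stepE //; move: (hr ab).
by case: c x y => [] [] []; rewrite /= ?muln1 ?muln0; lia.
Qed.

(** Apart from the lowest bits and the debt all terms are even, so that low part may be halved,
    rounding up. As [c] is at most 1, the added 1 keeps the subtraction from truncating. *)
Lemma borrow_step_le r c x y cs xs ys ab : admissible r ->
  (borrow_step r c x y ab + ab.1 * xs + ab.2 * ys <= cs) =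
  (r ab + ab.1 * (x + xs.*2) + ab.2 * (y + ys.*2) <= c + cs.*2).
Proof.
move=> hr; rewrite borrow_stepE // !mulnDr -!muln2 !mulnA.
set p := ab.1 * xs; set q := ab.2 * ys.
by case: c x y => [] [] []; rewrite /= ?muln1 ?muln0; lia.
Qed.

Lemma bit_of_bits s : bit_of (first_cell (bits s)) = (ohead s == Some true).
Proof. by case: s => [|[] s]. Qed.

Lemma adv_bits l s :
  move_tape (word l (bits s)) (first_cell (bits s), if first_cell (bits s) is Some _ then MoveRight else Stay)
  = word (catrev (bits (take 1 s)) l) (bits (behead s)).
Proof. by case: s => [|b [|b' s]]. Qed.

(** A number that has ended goes on as zeros, its head staying on the blank; once all three have
    ended the inequality says that the debt is 0. Tapes 2 and 4 are not read again, so their final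
    form is left open. *)
Lemma arith_loop N c x y e r a f lc lx ly tX tY tK : admissible r ->
  size c <= N -> size x <= N -> size y <= N ->
  exists r' : borrows, exists tx ty,
   (forall ab, (r' ab == ord0) = (r ab + ab.1 * value x + ab.2 * value y <= value c)) /\
   reach N.+1
    ((Arith, (e, r, a, f)), mk6 (word lc (bits c)) tX (word lx (bits x)) tY (word ly (bits y)) tK)
    ((Map true, (e, r', a, f)), mk6 (word (catrev (bits c) lc) [::]) tX tx tY ty tK).
Proof.
elim: N c x y r lc lx ly => [|N IH] c x y r lc lx ly hr hc hx hy.
  case: c hc => // _; case: x hx => // _; case: y hy => // _.
  exists r; exists (word lx [::]), (word ly [::]); split=> [ab|].
    by rewrite /= !muln0 !addn0 leqn0.
  by apply: reachS; rewrite mstepE //= !move_same; apply: reach0.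
case E: [|| first_cell (bits c) : bool, first_cell (bits x) : bool | first_cell (bits y) : bool]; last first.
  case: c {hc} E => //; case: x {hx} => //; case: y {hy} => // _.
  exists r; exists (word lx [::]), (word ly [::]); split=> [ab|].
    by rewrite /= !muln0 !addn0 leqn0.
  by apply: reachS; rewrite mstepE //= !move_same; apply: reach0.
set c0 := ohead c == Some true; set x0 := ohead x == Some true; set y0 := ohead y == Some true.
have := IH (behead c) (behead x) (behead y) (borrow_step r c0 x0 y0)
  (catrev (bits (take 1 c)) lc) (catrev (bits (take 1 x)) lx) (catrev (bits (take 1 y)) ly).
case; try by rewrite size_behead; lia.
  exact: borrow_step_admissible.
move=> r' [tx [ty [Hr' Hreach]]]; exists r', tx, ty; split=> [ab|].
  by rewrite Hr' borrow_step_le // (value_split c) (value_split x) (value_split y).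
apply: reachS; rewrite mstepE // /control.
rewrite [nth None _ 0]/= [nth None _ 2]/= [nth None _ 4]/= E.
rewrite !bit_of_bits -/c0 -/x0 -/y0 /acts.
apply: reach_eq Hreach; last by case: (c) => //= b s; rewrite take0.
by congr (_, mk6 _ _ _ _ _ _); rewrite /= ?move_same ?adv_bits.
Qed.

(** * Reading the fields of the input *)

Notation sym x := (inl x : letter).

Definition marks k : seq letter := nseq k (sym None).

Lemma parse_bits fresh e r a f l s rest m t1 t2 t3 t4 : s != [::] ->
  reach (size s)
    ((ParseM fresh, (e, r, a, f)),
     mk6 (word l (bits s ++ rest)) t1 t2 t3 t4 (word (marks m) [::]))
    ((ParseM false, (e || has id s, r, a, f)),
     mk6 (word (catrev (bits s) l) rest) t1 t2 t3 t4 (word (marks (m + size s)) [::])).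
Proof.
elim: s fresh e l m => // b s IH fresh e l m _.
apply: reachS; rewrite mstepE //= !move_same.
case: s IH => [|b' s] IH.
  by rewrite /= orbF addn1; apply: reach0.
have := IH false (e || b) (sym (Some b) :: l) m.+1 isT.
by rewrite -orbA addSnnS.
Qed.

Definition row_tape (s : seq bool) : seq letter := rcons (bits s) (sym None).

(** A nonempty row clears the flag before its separator, so the section does not end early. Every
    letter, separators included, leaves a mark on tape 5. *)
Lemma parse_rows rows e r a f l rest m t1 t2 t3 t4 : all (fun s => s != [::]) rows ->
  let w := flatten [seq row_tape s | s <- rows] in
  reach (size w)
    ((ParseM true, (e, r, a, f)),
     mk6 (word l (w ++ rest)) t1 t2 t3 t4 (word (marks m) [::]))
    ((ParseM true, (e || has (has id) rows, r, a, f)),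
     mk6 (word (catrev w l) rest) t1 t2 t3 t4 (word (marks (m + size w)) [::])).
Proof.
elim: rows e l m => [|s rows IH] e l m /=.
  by move=> _; rewrite orbF addn0; apply: reach0.
case/andP=> hs hrows; set w := flatten _.
rewrite [row_tape s]/row_tape -cats1 -!catA size_cat size_cat /=.
apply: (@reach_trans (size s) (size w).+1); last by rewrite size_map /=; lia.
  exact: parse_bits.
apply: reachS; rewrite mstepE //= !move_same.
apply: reach_eq (IH (e || has id s) (sym None :: catrev (bits s) l) (m + size s).+1 hrows).
- by [].
- rewrite size_map catrev_catl /= -orbA -/w.
  by rewrite (_ : m + (size s + (1 + size w)) = (m + size s + size w).+1) //; lia.
Qed.

Lemma parse_field k rg l s rest t1 t2 t3 t4 t5 l' : s != [::] -> (if k is FldEnd then false else true) ->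
  reach (size s).+1
    ((ParseB true k, rg),
     set_tape (mk6 (word l (row_tape s ++ rest)) t1 t2 t3 t4 t5) (field_tape k) (word l' [::]))
    ((ParseB true (next_field k), rg),
     set_tape (mk6 (word (catrev (row_tape s) l) rest) t1 t2 t3 t4 t5) (field_tape k)
       (word (catrev (bits s) l') [::])).
Proof.
case: rg => [[[e r] a] f] + hk; rewrite /row_tape -cats1 -catA /= catrev_catl.
(* The flag drops to false after the first bit, so the induction needs it arbitrary. *)
move: {1}true => fresh; elim: s fresh l l' => // b s IH fresh l l' _.
apply: reachS.
have -> : mstep ((ParseB fresh k, (e, r, a, f)),
     set_tape (mk6 (word l (bits (b :: s) ++ sym None :: rest)) t1 t2 t3 t4 t5) (field_tape k) (word l' [::]))
   = ((ParseB false k, (e, r, a, f)),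
     set_tape (mk6 (word (sym (Some b) :: l) (bits s ++ sym None :: rest)) t1 t2 t3 t4 t5)
       (field_tape k) (word (sym (Some b) :: l') [::])).
  by rewrite !set_tape_mk6; clear IH; case: k hk => //= _; rewrite mstepE //= !move_same.
case: s IH => [|b' s] IH; last exact: IH.
apply: reachS; apply: reach_eq (reach0 _ _) => //.
by rewrite !set_tape_mk6; clear IH; case: k hk => //= _; rewrite mstepE //= !move_same.
Qed.

(** * Sweeps over the adjacency matrix *)

Fixpoint gather (a : status) (row : seq bool) (xs : seq status) : status :=
  match row, xs with
  | b :: row', x :: xs' => gather (if b then or_status a x else a) row' xs'
  | _, _ => a
  end.

Definition stats (xs : seq status) : seq letter := [seq inr x | x <- xs].

Lemma row_loop e r a f l lx ly row rest xs y ys t2 t4 t5 : size row = size xs ->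
  let acc := gather a row xs in
  reach (size row).+1
    ((Row, (e, r, a, f)),
     mk6 (word l (row_tape row ++ rest)) (word lx (stats xs)) t2
         (word ly (stats (y :: ys))) t4 t5)
    ((RowStart, (e, r, acc, alarms f y acc)),
     mk6 (word (catrev (row_tape row) l) rest) (word (catrev (stats xs) lx) [::]) t2
         (word (inr (next_status y acc) :: ly) (stats ys)) t4 t5).
Proof.
rewrite /row_tape -cats1 -catA catrev_catl.
elim: row xs a l lx => [|b row IH] [|x xs] a l lx //=.
  by move=> _; apply: reachS; rewrite mstepE //= !move_same; apply: reach0.
move=> [hs]; apply: reachS; rewrite mstepE //= !move_same.
exact: (IH xs _ (_ :: _) (_ :: _)).
Qed.

(** [xs] is the full status word on tape 1, [ys] the part of tape 3 still to be updated. As [xs]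
    stays fixed, all vertices are updated simultaneously. *)
Fixpoint pass_alarms (f : alarm * alarm) (rows : seq (seq bool)) (xs ys : seq status) :=
  match rows, ys with
  | row :: rows', y :: ys' =>
    pass_alarms (alarms f y (gather zero_status row xs)) rows' xs ys'
  | _, _ => f
  end.
Fixpoint pass_status (rows : seq (seq bool)) (xs ys : seq status) : seq status :=
  match rows, ys with
  | row :: rows', y :: ys' =>
    next_status y (gather zero_status row xs) :: pass_status rows' xs ys'
  | _, _ => [::]
  end.

Lemma rewindE s rg t0 t1 t2 t3 t4 t5 l r :
  nth t0 [:: t0; t1; t2; t3; t4; t5] (site_tape s) = word l r ->
  reach (size l).+2 ((Rew s true, rg), mk6 t0 t1 t2 t3 t4 t5)
    ((site_next s, rg), set_tape (mk6 t0 t1 t2 t3 t4 t5) (site_tape s) (word [::] (catrev l r))).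
Proof. by move=> E; apply: rewind; rewrite ffunE inordK //; case: (s). Qed.

(** Tape 1 is rewound at the start of each row, so only its content [catrev lx rx] is tracked, not
    its head. A row costs one test, a rewind of at most [size xs + 2] steps and a scan of
    [size xs + 1]. *)
Lemma rows_loop rows e r a f l lx rx ly rest xs ys t2 t4 t5 :
  size rows = size ys -> 0 < size xs -> all (fun row => size row == size xs) rows ->
  catrev lx rx = stats xs ->
  exists a' lx' rx', catrev lx' rx' = stats xs /\ reach (size rows * (2 * size xs + 4))
    ((RowStart, (e, r, a, f)),
     mk6 (word l (flatten [seq row_tape s | s <- rows] ++ rest)) (word lx rx) t2
         (word ly (stats ys)) t4 t5)
    ((RowStart, (e, r, a', pass_alarms f rows xs ys)),
     mk6 (word (catrev (flatten [seq row_tape s | s <- rows]) l) rest) (word lx' rx') t2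
         (word (catrev (stats (pass_status rows xs ys)) ly) [::]) t4 t5).
Proof.
elim: rows ys a f l lx rx ly => [|row rows IH] [|y ys] a f l lx rx ly //=.
  by move=> _ _ _ h; exists a, lx, rx; split=> //; apply: reach0.
move=> [hs] xs0 /andP[/eqP hrow hrows] hx.
have hlx : size lx <= size xs.
  by have := congr1 size hx; rewrite catrevE size_cat size_rev size_map; lia.
set acc := gather zero_status row xs.
have := IH ys acc (alarms f y acc) (catrev (row_tape row) l) (catrev (stats xs) [::]) [::]
  (inr (next_status y acc) :: ly) hs xs0 hrows.
case; first by rewrite -!/(rev _) revK.
move=> a' [lx' [rx' [hx' hr]]]; exists a', lx', rx'; split=> //.
rewrite catrev_catl -catA mulSn.
apply: (reach_trans _ hr (leqnn _)).
(* [RowStart] recognizes a further row by its first bit, so the row must be nonempty. *)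
case: row hrow @acc hr => [|b row] hrow acc hr; first by rewrite -hrow in xs0.
apply: (@reach_trans 1 (size lx + 2 + (size xs).+1)); last lia.
  apply: reachS; rewrite mstepE //= !move_same; exact: reach0.
apply: reach_trans.
- by apply: (@rewindE SiteRow); reflexivity.
- rewrite set_tape_mk6 /= hx; apply: (@row_loop e r zero_status f l [::] ly (b :: row)) => //.
- rewrite hrow; lia.
Qed.

(** Tape 5 with [k] marks left and the head on the last one. The first [unmark] only steps back onto
    it from the blank beyond; later ones erase a mark each. *)
Definition counter k : tape cell :=
  if k is k'.+1 then word (marks k') [:: sym None] else word [::] [::].

Lemma unmark_marks k : move_tape (word (marks k) [::]) (None, MoveLeft) = counter k.
Proof. by case: k. Qed.

Lemma unmark_counter k : move_tape (counter k.+1) (None, MoveLeft) = counter k.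
Proof. by case: k. Qed.

Lemma size_pass_status rows xs ys :
  size rows = size ys -> size (pass_status rows xs ys) = size ys.
Proof. by elim: rows ys => [|row rows IH] [|y ys] //= [/IH->]. Qed.

Lemma zipwith_copy xs ys : size ys = size xs -> zipwith copy xs ys = ys.
Proof. by elim: xs ys => [|x xs IH] [|y ys] //= [/IH->]. Qed.

(** The separator behind the matrix ends the row loop. Then tapes 1 and 3 are rewound, tape 3 is
    copied onto tape 1, and tapes 3 and 0 are rewound for the next sweep. *)
Lemma pass_loop rows e r a f xs k lx rx rest t2 t4 :
  0 < size xs -> size rows = size xs ->
  all (fun row => size row == size xs) rows -> catrev lx rx = stats xs ->
  let W := flatten [seq row_tape s | s <- rows] ++ sym None :: rest in
  let new := pass_status rows xs xs in
  exists a' lx' rx', catrev lx' rx' = stats new /\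
  reach (size xs * (2 * size xs + 4) + 4 * size xs + size W + 20)
    ((Pass, (e, r, a, f)), mk6 (word [::] W) (word lx rx) t2 (word [::] (stats xs)) t4 (counter k.+1))
    ((Pass, (e, r, a', pass_alarms no_alarm rows xs xs)),
     mk6 (word [::] W) (word lx' rx') t2 (word [::] (stats new)) t4 (counter k)).
Proof.
move=> n0 hr hrows hx W new.
have [a' [lx' [rx' [hx']]]] := @rows_loop rows e r a no_alarm [::] lx rx [::] (sym None :: rest)
  xs xs t2 t4 (counter k) hr n0 hrows hx.
rewrite -/new -/W; set F := flatten _ => hreach.
have snew : size (stats new) = size xs by rewrite size_map size_pass_status.
have hlx : size lx' <= size xs.
  by have := congr1 size hx'; rewrite catrevE size_cat size_rev size_map; lia.
exists a', (catrev (stats new) [::]), [::]; split; first by rewrite -!/(rev _) revK.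
apply: (@reach_trans 1 (size xs * (2 * size xs + 4) + 4 * size xs + size W + 19)); last lia.
  apply: reachS; rewrite mstepE //= !move_same unmark_counter; exact: reach0.
apply: (reach_trans hreach (n2 := (4 * size xs + size W + 18).+1)); last by rewrite hr; lia.
apply: reachS; rewrite mstepE //= !move_same.
apply: (@reach_trans (size lx').+2 (3 * size xs + size W + 16)); last lia.
  by apply: (@rewindE SiteX); reflexivity.
rewrite set_tape_mk6 /= hx'.
apply: (@reach_trans (size xs).+2 (2 * size xs + size W + 14)); last lia.
  apply: reach_le; first by apply: (@rewindE SiteXY); reflexivity.
  by rewrite -!/(rev _) size_rev snew.
rewrite set_tape_mk6 /= -!/(rev _) revK.
apply: (@reach_trans (size xs).+1 (size xs + size W + 13)); last lia.
  apply: reach_le; first by apply: map_loop; rewrite snew size_map.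
  by rewrite size_map.
rewrite zipwith_copy ?snew ?size_map //.
apply: (@reach_trans (size xs).+2 (size W + 11)); last lia.
  apply: reach_le; first by apply: (@rewindE SiteY); reflexivity.
  by rewrite -!/(rev _) size_rev snew.
rewrite set_tape_mk6 /= -!/(rev _) revK.
apply: reach_le; first apply: reach_eq (erefl _) _ (@rewindE SiteI _ _ _ _ _ _ _ _ _ (erefl _)).
  by rewrite set_tape_mk6 /= -/(rev _) catrevE revK.
by rewrite size_rev /W size_cat -/F /=; lia.
Qed.

(** Every sweep starts from [no_alarm], so the report of the last one survives. *)
Fixpoint final_alarms k rows xs f :=
  if k is k'.+1
  then final_alarms k' rows (pass_status rows xs xs) (pass_alarms no_alarm rows xs xs)
  else f.

(** Nonemptiness is asked for only if there is a sweep to make: the empty graph leaves an empty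
    counter. *)
Lemma passes_loop k rows e r a f xs lx rx rest t2 t4 :
  (0 < k -> 0 < size xs) -> size rows = size xs ->
  all (fun row => size row == size xs) rows -> catrev lx rx = stats xs ->
  let W := flatten [seq row_tape s | s <- rows] ++ sym None :: rest in
  exists rg T,
  reach (k * (size xs * (2 * size xs + 4) + 4 * size xs + size W + 20) + 1)
    ((Pass, (e, r, a, f)), mk6 (word [::] W) (word lx rx) t2 (word [::] (stats xs)) t4 (counter k))
    ((Halt (answer e r (final_alarms k rows xs f)), rg), T).
Proof.
elim: k a f xs lx rx => [|k IH] a f xs lx rx h0 hr hrows hx W.
  do 2 eexists; rewrite addn1; apply: reachS; rewrite mstepE //= !move_same; exact: reach0.
have [a' [lx' [rx' [hx' hreach]]]] :=
  @pass_loop rows e r a f xs k lx rx rest t2 t4 (h0 isT) hr hrows hx.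
have snew : size (pass_status rows xs xs) = size xs by rewrite size_pass_status.
have := IH a' (pass_alarms no_alarm rows xs xs) (pass_status rows xs xs) lx' rx'.
rewrite snew => /(_ (fun _ => h0 isT) hr hrows hx') [rg [T hT]].
exists rg, T; apply: (reach_trans hreach hT); rewrite -/W; lia.
Qed.

(** * Initial statuses, the bundle section and the complete run *)

Fixpoint init_status (b1 b2 : seq bool) : seq status :=
  if b1 is x :: b1' then bit_status x (head false b2) :: init_status b1' (behead b2)
  else [::].

Lemma zipwith_merge b1 b2 : zipwith merge (bits b1) (bits b2) = stats (init_status b1 b2).
Proof.
elim: b1 b2 => [|x b1 IH] [|y b2] //=; rewrite -IH //.
Qed.

Lemma size_init_status b1 b2 : size (init_status b1 b2) = size b1.
Proof. by elim: b1 b2 => //= x b1 IH b2; rewrite IH. Qed.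

Definition bundles_tape (bs : seq (seq bool * seq bool)) : seq letter :=
  flatten [seq row_tape p.1 ++ row_tape p.2 | p <- bs].

Definition entry i (bs : seq (seq bool * seq bool)) := nth ([::], [::]) bs i.

Definition blank_tape : tape cell := word [::] [::].

(** At most two bundles make at most four fields, each with a tape of its own, so every possible
    number of bundles is run explicitly. The tapes of a missing bundle stay blank, in accordance
    with the default of [entry]. *)
Lemma parse_bundles bs rg l rest m : size bs <= 2 ->
  all (fun p => (p.1 != [::]) && (p.2 != [::])) bs ->
  let w := rcons (bundles_tape bs) (sym None) in
  reach (size w)
    ((ParseB true Fld1, rg),
     mk6 (word l (w ++ rest)) (word [::] [::]) (word [::] [::]) (word [::] [::]) (word [::] [::])
         (word (marks m) [::]))
    ((Rew Site1 true, rg),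
     mk6 (word (catrev w l) rest)
         (word (rev (bits (entry 0 bs).1)) [::]) (word (rev (bits (entry 0 bs).2)) [::])
         (word (rev (bits (entry 1 bs).1)) [::]) (word (rev (bits (entry 1 bs).2)) [::])
         (counter m)).
Proof.
have last_step k l' t1 t2 t3 t4 :
    reach 1 ((ParseB true k, rg), mk6 (word l' (sym None :: rest)) t1 t2 t3 t4 (word (marks m) [::]))
      ((Rew Site1 true, rg), mk6 (word (sym None :: l') rest) t1 t2 t3 t4 (counter m)).
  case: (rg) => [[[e r] a] f]; apply: reachS.
  rewrite mstepE // /control [nth None _ 0]/= /acts [foldr]lock /= -lock /=.
  by rewrite !move_same unmark_marks; apply: reach0.
have field k l' s rest' t1 t2 t3 t4 t5 : s != [::] -> (if k is FldEnd then false else true) ->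
    reach (size s).+1
      ((ParseB true k, rg),
       set_tape (mk6 (word l' (row_tape s ++ rest')) t1 t2 t3 t4 t5) (field_tape k) (word [::] [::]))
      ((ParseB true (next_field k), rg),
       set_tape (mk6 (word (catrev (row_tape s) l') rest') t1 t2 t3 t4 t5) (field_tape k)
         (word (rev (bits s)) [::])) by move=> hs hk; apply: parse_field.
rewrite /bundles_tape; case: bs => [|[b1 w1] [|[b2 w2] []]] //= _.
- rewrite !andbT cats0 => /andP[h1 h2].
  rewrite -cats1 -!catA !size_cat !size_rcons !catrev_catl !size_map.
  apply: (@reach_trans (size b1).+1 ((size w1).+1 + 1)); last by rewrite /=; lia.
    have := field Fld1 l b1 (row_tape w1 ++ sym None :: rest) blank_tape blank_tape blank_tape
      blank_tape (word (marks m) [::]) h1 isT.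
    by rewrite !set_tape_mk6 /=; apply.
  apply: (@reach_trans (size w1).+1 1 _ _ _ _ _ (last_step _ _ _ _ _ _)) => //.
  have := field Fld2 (catrev (row_tape b1) l) w1 (sym None :: rest) (word (rev (bits b1)) [::]) blank_tape
    blank_tape blank_tape (word (marks m) [::]) h2 isT.
  by rewrite !set_tape_mk6 /=; apply.
- rewrite !andbT cats0 => /andP[/andP[h1 h2] /andP[h3 h4]].
  rewrite -cats1 -!catA !size_cat !size_rcons !catrev_catl !size_map.
  apply: (@reach_trans (size b1).+1 ((size w1).+1 + ((size b2).+1 + ((size w2).+1 + 1))));
    last by rewrite /=; lia.
    have := field Fld1 l b1 (row_tape w1 ++ row_tape b2 ++ row_tape w2 ++ sym None :: rest)
      blank_tape blank_tape blank_tape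
      blank_tape (word (marks m) [::]) h1 isT.
    by rewrite !set_tape_mk6 /=; apply.
  apply: (@reach_trans (size w1).+1 ((size b2).+1 + ((size w2).+1 + 1))) => //.
    have := field Fld2 (catrev (row_tape b1) l) w1 (row_tape b2 ++ row_tape w2 ++ sym None :: rest)
      (word (rev (bits b1)) [::]) blank_tape
      blank_tape blank_tape (word (marks m) [::]) h2 isT.
    by rewrite !set_tape_mk6 /=; apply.
  apply: (@reach_trans (size b2).+1 ((size w2).+1 + 1)) => //.
    have := field Fld3 (catrev (row_tape w1) (catrev (row_tape b1) l)) b2
      (row_tape w2 ++ sym None :: rest)
      (word (rev (bits b1)) [::]) (word (rev (bits w1)) [::])
      blank_tape blank_tape (word (marks m) [::]) h3 isT.
    by rewrite !set_tape_mk6 /=; apply.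
  apply: (@reach_trans (size w2).+1 1 _ _ _ _ _ (last_step _ _ _ _ _ _)) => //.
  have := field Fld4 (catrev (row_tape b2) (catrev (row_tape w1) (catrev (row_tape b1) l))) w2
    (sym None :: rest)
    (word (rev (bits b1)) [::]) (word (rev (bits w1)) [::]) (word (rev (bits b2)) [::])
    blank_tape (word (marks m) [::]) h4 isT.
  by rewrite !set_tape_mk6 /=; apply.
Qed.

Definition input_tape (rows : seq (seq bool)) bs (c : seq bool) : seq letter :=
  flatten [seq row_tape s | s <- rows] ++
  sym None :: rcons (bundles_tape bs) (sym None) ++ bits c.

Lemma fitsE (r : borrows) a b x y c : a < 4 -> b < 4 ->
  (forall ab, (r ab == ord0) = ((ab.1 : 'I_4) * x + (ab.2 : 'I_4) * y <= c)) ->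
  fits r a b = (a * x + b * y <= c).
Proof. by move=> ha hb h; rewrite /fits h /= !inordK. Qed.

(** At most [m] sweeps, each of quadratic cost, dominate the run. *)
Definition time_bound m := 100 * m.+1 ^ 3.

Lemma machine_run rows bs c n :
  size rows = n -> all (fun row => size row == n) rows -> size bs <= 2 ->
  size (entry 0 bs).1 = n -> size (entry 1 bs).1 <= n ->
  all (fun p => (p.1 != [::]) && (p.2 != [::])) bs ->
  let w := input_tape rows bs c in
  let xs := init_status (entry 0 bs).1 (entry 1 bs).1 in
  let cost a b := a * value (entry 0 bs).2 + b * value (entry 1 bs).2 <= value c in
  exists r rg T,
    (forall a b, a < 4 -> b < 4 -> fits r a b = cost a b) /\
    reach (time_bound (size w))
      ((ParseM true, regs0),
       mk6 (word [::] w) blank_tape blank_tape blank_tape blank_tape blank_tape)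
      ((Halt (answer (has (has id) rows) r
          (final_alarms (size (flatten [seq row_tape s | s <- rows])) rows xs no_alarm)), rg), T).
Proof.
move=> hn hrows hbs h0 h1 hne w xs cost.
set F := flatten _; set e := has _ _.
set X := (entry 0 bs).1 in h0 xs *; set Y := (entry 1 bs).1 in h1 xs *.
set V := (entry 0 bs).2 in cost *; set U := (entry 1 bs).2 in cost *.
set r0 : borrows := [ffun=> ord0].
have hr0 : admissible r0 by move=> ab; rewrite ffunE.
have nF : n <= size F.
  rewrite /F -hn; elim: (rows) => //= row rs IH; rewrite size_cat size_rcons; lia.
have sw : size w = size F + (size (bundles_tape bs) + size c).+2.
  by rewrite size_cat /= size_cat size_rcons size_map.
have [sV sU] : size V <= size (bundles_tape bs) /\ size U <= size (bundles_tape bs).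
  rewrite /V /U /bundles_tape.
  by case: (bs) hbs => [|p [|q []]] //= _; rewrite !size_cat !size_rcons !size_map; split; lia.
(* An empty row would mean [n = 0], but then there is no row at all. *)
have hrows' : all (fun s => s != [::]) rows.
  apply/allP => row /[dup] hin /(allP hrows) /eqP hs.
  by case: row hin hs => // hin /= E0; rewrite -E0 in hn; move: hin; rewrite (size0nil hn).
set W := word [::] w.
set m := size w in nF sw *.
have [r' [tx [ty [Hr' Harith]]]] := @arith_loop m c V U e r0 zero_status no_alarm
   (catrev (rcons (bundles_tape bs) (sym None)) (sym None :: catrev F [::])) [::] [::] (word [::] (bits X)) (word [::] (bits Y)) (counter (size F)) hr0
   ltac:(lia) ltac:(lia) ltac:(lia).
have := @passes_loop (size F) rows e r' zero_status no_alarm xs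
  (catrev (stats xs) [::]) [::] (rcons (bundles_tape bs) (sym None) ++ bits c) tx ty.
rewrite -/F -/(input_tape rows bs c) -/w size_init_status h0.
case; rewrite ?hn //.
- by rewrite /F -hn; case: (rows).
- by rewrite -[LHS]/(rev (rev _)) revK.
move=> rg [T Hpass]; exists r', rg, T; split.
  move=> a b ha hb; rewrite (@fitsE _ _ _ (value V) (value U) (value c)) // => ab.
  by rewrite Hr' ffunE.
have rewE s : catrev (rev (bits s)) [::] = bits s by rewrite -/(rev _) revK.
(* The number of steps is left open here: it builds up as the sum over the phases and is compared
   with [time_bound] at the very end. *)
apply: reach_le.
  apply: reach_cat.
    exact: (@parse_rows rows false r0 zero_status no_alarm [::] _ 0 _ _ _ _ hrows').
  rewrite -/F orFb -/e add0n.
  apply: reach_cat.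
    by apply: reachS; rewrite mstepE //= !move_same; exact: (reach0 0).
  apply: reach_cat; first exact: (@parse_bundles bs (e, r0, zero_status, no_alarm) (sym None :: catrev F [::]) (bits c) (size F) hbs hne).
  rewrite -/X -/Y -/V -/U.
  apply: reach_cat; first by apply: (@rewindE Site1); reflexivity.
  rewrite set_tape_mk6 /= rewE.
  apply: reach_cat; first by apply: (@rewindE Site2); reflexivity.
  rewrite set_tape_mk6 /= rewE.
  apply: reach_cat; first by apply: (@rewindE Site3); reflexivity.
  rewrite set_tape_mk6 /= rewE.
  apply: reach_cat; first by apply: (@rewindE Site4); reflexivity.
  rewrite set_tape_mk6 /= rewE.
  apply: reach_cat; first exact: Harith.
  apply: reach_cat; first by apply: map_loop; rewrite !size_map h0.
  rewrite zipwith_merge -/xs.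
  apply: reach_cat; first by apply: (@rewindE SiteY); reflexivity.
  rewrite set_tape_mk6 /= -[catrev (catrev (stats xs) _) _]/(rev (rev _)) revK.
  apply: reach_cat; first by apply: (@rewindE SiteI); reflexivity.
  rewrite set_tape_mk6 /=.
  have -> : catrev (catrev (bits c) (catrev (rcons (bundles_tape bs) (sym None)) (sym None :: catrev F [::]))) [::] = w.
    by rewrite !catrevE !cats0 !rev_cat rev_cons !revK cat_rcons -!catA.
  exact: Hpass.
rewrite -/m -/F !catrevE !size_cat /= !size_rev !size_cat !size_rev /= !size_rcons !size_map size_init_status -/F.
have hF : size F * (n * (2 * n + 4) + 4 * n + m + 20) <= m * (m * (2 * m + 4) + 4 * m + m + 20).
  have : n * (2 * n + 4) <= m * (2 * m + 4) by apply: leq_mul; lia.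
  by move=> ?; apply: leq_mul; lia.
move: hF; rewrite /time_bound !expnS expn0; set q := size F * _ => hF; lia.
Qed.

(** * Two bundles on a bipartite graph *)

(* [(v, false)] stands for [v] in [S], [(v, true)] for [v] in [T]. *)
Definition grow n (e : rel 'I_n) (B : {set 'I_n}) (X : {set 'I_n * bool}) :
    {set 'I_n * bool} :=
  [set p : 'I_n * bool | ~~ p.2 && (p.1 \in B)
                      || [exists v, e p.1 v && ((v, ~~ p.2) \in X)]].

Definition layer n (e : rel 'I_n) B k := iter k (grow e B) set0.

Definition inner_edge n (e : rel 'I_n) (B : {set 'I_n}) : bool :=
  [exists u in B, exists v in B, e u v].
Definition clash n (e : rel 'I_n) B k : bool :=
  [exists u, ((u, false) \in layer e B k) && ((u, true) \in layer e B k)].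

Lemma grow_mono n (e : rel 'I_n) B : {homo grow e B : X Y / X \subset Y}.
Proof.
move=> X Y /subsetP h; apply/subsetP => p; rewrite !inE.
case/orP => [->//|/existsP[v /andP[ev hv]]]; apply/orP; right.
by apply/existsP; exists v; rewrite ev h.
Qed.

(** Iterating a monotone operator from the empty set gives an increasing chain, which in a set of
    [2n] elements is stationary after [2n] steps. *)
Lemma layer_fix n (e : rel 'I_n) B k : n * 2 <= k -> grow e B (layer e B k) = layer e B k.
Proof.
move=> hk; have hc : #|{: 'I_n * bool}| = n * 2 by rewrite card_prod card_ord card_bool.
have hf : grow e B (iter (n * 2) (grow e B) set0) = iter (n * 2) (grow e B) set0.
  by have := fixsetK (@grow_mono n e B); rewrite /fixset hc.
by rewrite /layer -(subnK hk) iterD iter_fix.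
Qed.

Lemma inner_edge_free_coloring n (e : rel 'I_n) B (A : {set 'I_n}) : symmetric e ->
  (forall u v, e u v -> (u \in A) != (v \in A)) -> ~~ inner_edge e B ->
  exists c, [/\ proper_coloring e c, forall v, v \in B -> c v <= 1 & forall v, c v <= 3].
Proof.
move=> esym hA /existsPn hB.
exists (fun v => if v \in B then 1 else if v \in A then 2 else 3); split.
- split=> [v|u v euv]; first by case: ifP => // _; case: ifP.
  have := hA _ _ euv; have := hB u.
  case hu: (u \in B) => /=; case hv: (v \in B) => //=.
  - by move/existsPn => /(_ v); rewrite hv euv.
  - by case: (v \in A).
  - by case: (u \in A).
  - by case: (u \in A); case: (v \in A).
- by move=> v ->.
- by move=> v; case: ifP => // _; case: ifP.
Qed.

(** Color [S] with 1, [T] with 2 and the unreached vertices by their side. The layer is a fixpoint,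
    so neighbors of [S] lie in [T] and conversely, and unreached vertices have no reached
    neighbor. *)
Lemma clash_free_coloring n (e : rel 'I_n) B (A : {set 'I_n}) k : symmetric e ->
  (forall u v, e u v -> (u \in A) != (v \in A)) -> n * 2 <= k -> ~~ clash e B k ->
  exists c, [/\ proper_coloring e c, forall v, v \in B -> c v <= 1 & forall v, c v <= 2].
Proof.
move=> esym hA hk /existsPn hcl.
set X := layer e B k in hcl.
have hX : grow e B X = X by apply: layer_fix.
have hB v : v \in B -> (v, false) \in X by move=> vB; rewrite -hX inE /= vB.
have hN u v b : e u v -> (u, b) \in X -> (v, ~~ b) \in X.
  move=> euv uX; rewrite -hX inE /=; apply/orP; right.
  by apply/existsP; exists u; rewrite esym euv negbK.
exists (fun v => if (v, false) \in X then 1 else if (v, true) \in X then 2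
                 else if v \in A then 1 else 2); split.
- split=> [v|u v euv]; first by do 3?case: ifP => // _.
  have evu : e v u by rewrite esym.
  case u0: ((u, false) \in X).
    have v1 := hN _ _ _ euv u0; rewrite /= in v1.
    by have := hcl v; rewrite v1 andbT => /negPf->.
  case v0: ((v, false) \in X).
    have u1 := hN _ _ _ evu v0; rewrite /= in u1; by rewrite u1.
  case u1: ((u, true) \in X); first by have := hN _ _ _ euv u1; rewrite v0.
  case v1: ((v, true) \in X); first by have := hN _ _ _ evu v1; rewrite u0.
  by have := hA _ _ euv; case: (u \in A); case: (v \in A).
- by move=> v /hB ->.
- by move=> v; do 3?case: ifP.
Qed.

(** With two colors and 1 on [B], colors are forced to alternate along every walk from [B], so the
    parity of a walk determines the color of its end. *)
Lemma clash_free n (e : rel 'I_n) (B : {set 'I_n}) k c : proper_coloring e c ->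
  (forall v, v \in B -> c v <= 1) -> (forall v, c v <= 2) -> ~~ clash e B k.
Proof.
move=> [c0 hc] cB c2.
have H j v b : (v, b) \in layer e B j -> c v = b.+1.
  elim: j v b => [|j IH] v b; first by rewrite inE.
  rewrite /layer iterS inE /= => /orP[/andP[]|/existsP[u /andP[evu /IH hu]]].
    by case: b => // _ /cB; have := c0 v; lia.
  have := hc _ _ evu; have := c0 v; have := c2 v; rewrite hu.
  by case: b {hu}; lia.
by apply/existsPn => u; apply/negP => /andP[/H + /H] => ->.
Qed.

Definition side_answer n (e : rel 'I_n) B1 B2 k (fit : nat -> nat -> bool) : bool :=
  [|| [forall u, forall v, ~~ e u v] && fit 1 1, fit 2 2,
      ~~ inner_edge e B1 && fit 1 3, ~~ clash e B1 k && fit 1 2,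
      ~~ inner_edge e B2 && fit 3 1 | ~~ clash e B2 k && fit 2 1].

(** A coloring with both maxima at least 2 is dominated by [(2, 2)]. If one maximum is at most 1,
    the other being at most 1, equal to 2 or larger leads to the edgeless, the clash-free or the
    independent case. *)
Lemma two_bundles n (e : rel 'I_n) (A B1 B2 : {set 'I_n}) w1 w2 C k :
  symmetric e -> (forall u v, e u v -> (u \in A) != (v \in A)) ->
  (forall v, (v \in B1) || (v \in B2)) ->
  (B1 = set0 -> w1 = 0) -> (B2 = set0 -> w2 = 0) -> n * 2 <= k ->
  (exists c, proper_coloring e c /\
     w1 * (\max_(v in B1) c v) + w2 * (\max_(v in B2) c v) <= C) <->
  side_answer e B1 B2 k (fun a b => a * w1 + b * w2 <= C).
Proof.
move=> esym hA hcov hw1 hw2 hk; split.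
- case=> c [hc]; set m1 := \max_(v in B1) _; set m2 := \max_(v in B2) _ => hC.
  have [c0 cE] := hc.
  have hm1 v : v \in B1 -> c v <= m1 by move=> h; apply: (leq_bigmax_cond v).
  have hm2 v : v \in B2 -> c v <= m2 by move=> h; apply: (leq_bigmax_cond v).
  (* A nonempty bundle has maximum at least 1; an empty one has maximum 0, but also weight 0. *)
  have pos B w m : (B = set0 -> w = 0) -> (forall v, v \in B -> c v <= m) -> w <= w * m.
    move=> hw hm; have [/hw->//|[v /hm]] := set_0Vmem B.
    by move=> h; rewrite leq_pmulr //; apply: leq_trans (c0 v) h.
  have p1 := pos _ _ _ hw1 hm1; have p2 := pos _ _ _ hw2 hm2.
  have edgeless : m1 <= 1 -> m2 <= 1 -> [forall u, forall v, ~~ e u v].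
    move=> l1 l2; have one v : c v = 1.
      have := c0 v; case/orP: (hcov v) => [/hm1|/hm2]; lia.
    apply/forallP => u; apply/forallP => v; apply/negP => /cE; by rewrite !one.
  have side (B : {set 'I_n}) m : (forall v, v \in B -> c v <= m) -> m <= 1 -> ~~ inner_edge e B.
    move=> hm l1; apply/existsPn => u; apply/negP => /andP[uB /existsP[v /andP[vB /cE]]].
    by apply; have := hm _ uB; have := hm _ vB; have := c0 u; have := c0 v; lia.
  rewrite /side_answer; have [l1|g1] := leqP m1 1.
    have [l2|g2] := leqP m2 1.
      by rewrite edgeless //= (_ : _ <= C) //; lia.
    have [l3|g3] := leqP m2 2.
      suff -> : ~~ clash e B1 k by rewrite (_ : 1 * w1 + 2 * w2 <= C) ?orbT //; nia.
      apply: clash_free hc _ _ => v; first by move/hm1; lia.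
      by case/orP: (hcov v) => [/hm1|/hm2]; lia.
    by rewrite (side _ _ hm1) // (_ : 1 * w1 + 3 * w2 <= C) ?orbT //; nia.
  have [l2|g2] := leqP m2 1; last by rewrite (_ : 2 * w1 + 2 * w2 <= C) ?orbT //; nia.
  have [l3|g3] := leqP m1 2.
    suff -> : ~~ clash e B2 k by rewrite (_ : 2 * w1 + 1 * w2 <= C) ?orbT //; nia.
    apply: clash_free hc _ _ => v; first by move/hm2; lia.
    by case/orP: (hcov v) => [/hm1|/hm2]; lia.
  by rewrite (side _ _ hm2) // (_ : 3 * w1 + 1 * w2 <= C) ?orbT //; nia.
(* Conversely, it is enough to give a coloring bounded by [a] on [B1] and by [b] on [B2]. *)
- have fit a b c : proper_coloring e c -> (forall v, v \in B1 -> c v <= a) ->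
    (forall v, v \in B2 -> c v <= b) -> a * w1 + b * w2 <= C ->
    exists c, proper_coloring e c /\
     w1 * (\max_(v in B1) c v) + w2 * (\max_(v in B2) c v) <= C.
    move=> hc h1 h2 h; exists c; split=> //; apply: leq_trans h.
    by rewrite ![_ * w1]mulnC ![_ * w2]mulnC leq_add // leq_mul2l; apply/orP; right; apply/bigmax_leqP.
  case/or4P => [/andP[he]|||/or3P[]].
  - apply: (fit _ _ (fun=> 1)) => //; split=> // u v euv.
    by move/forallP/(_ u)/forallP/(_ v): he; rewrite euv.
  - apply: (fit _ _ (fun v => if v \in A then 1 else 2)) => [|v _|v _]; try by case: ifP.
    split=> [v|u v /hA]; first by case: ifP.
    by case: (u \in A); case: (v \in A).
  - case/andP=> /(inner_edge_free_coloring esym hA)[c [h1 h2 h3]].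
    exact: (fit _ _ c).
  - case/andP=> /(clash_free_coloring esym hA hk)[c [h1 h2 h3]].
    exact: (fit _ _ c).
  - case/andP=> /(inner_edge_free_coloring esym hA)[c [h1 h2 h3]].
    exact: (fit _ _ c).
  - case/andP=> /(clash_free_coloring esym hA hk)[c [h1 h2 h3]].
    exact: (fit _ _ c).
Qed.

(** * From the machine to the instance *)

(** Indexing the two bundles by a boolean lets one argument serve both. *)
Definition sel (T : Type) (i : bool) (x : T * T) : T := if i then x.2 else x.1.

(** Each single flag [g] turns [or_status] into a disjunction, so on a gathered status it says that
    some selected vertex has the flag. *)
Lemma gather_has (g : status -> bool) (T : Type) (p : T -> bool) (st : T -> status) s a :
  (forall x y, g (or_status x y) = g x || g y) ->
  g (gather a (map p s) (map st s)) = g a || has (fun v => p v && g (st v)) s.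
Proof.
move=> hg; elim: s a => [|v s IH] a /=; first by rewrite orbF.
by rewrite IH; case: (p v); rewrite ?hg -?orbA.
Qed.

Lemma pass_status_map (U : Type) (row : U -> seq bool) xs (st : U -> status) (s : seq U) :
  pass_status (map row s) xs (map st s) =
  [seq next_status (st u) (gather zero_status (row u) xs) | u <- s].
Proof. by elim: s => //= u s ->. Qed.

Lemma pass_alarms_map i (U : Type) (row : U -> seq bool) xs (st : U -> status) (s : seq U) f :
  let acc u := sel i (gather zero_status (row u) xs) in
  let old u := sel i (st u) in
  sel i (pass_alarms f (map row s) xs (map st s)) =
  ((sel i f).1 || has (fun u => (old u).1.1 && (acc u).1.1) s,
   (sel i f).2 || has (fun u => ((old u).1.1 || (acc u).2) && (acc u).1.2) s).
Proof.
elim: s f => [|u s IH] f /=; first by rewrite !orbF -surjective_pairing.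
by rewrite IH; case: i {IH} => /=; rewrite -!orbA.
Qed.

Lemma has_enum n (p : pred 'I_n) : has p (enum 'I_n) = [exists u, p u].
Proof.
apply/hasP/existsP => [[u _ hu]|[u hu]]; first by exists u.
by exists u => //; rewrite mem_enum.
Qed.

Lemma sel_or i x y : sel i (or_status x y) = or3 (sel i x) (sel i y).
Proof. by case: i. Qed.

Definition flags_of n (e : rel 'I_n) (B : {set 'I_n}) k (v : 'I_n) : flags3 :=
  (v \in B, (v, false) \in layer e B k, (v, true) \in layer e B k).

Definition tracks n (e : rel 'I_n) (B : bool -> {set 'I_n}) k (st : 'I_n -> status) :=
  forall i v, sel i (st v) = flags_of e (B i) k v.

Definition rows_of n (e : rel 'I_n) : seq (seq bool) :=
  [seq [seq e u v | v <- enum 'I_n] | u <- enum 'I_n].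

Lemma gather_row n (e : rel 'I_n) B k st i u : tracks e B k st ->
  let acc := sel i (gather zero_status [seq e u v | v <- enum 'I_n] (map st (enum 'I_n))) in
  [/\ acc.1.1 = [exists v, e u v && (v \in B i)],
      acc.1.2 = [exists v, e u v && ((v, false) \in layer e (B i) k)]
    & acc.2 = [exists v, e u v && ((v, true) \in layer e (B i) k)]].
Proof.
move=> tr /=; have z : sel i zero_status = (false, false, false) by case: i.
split.
- rewrite (@gather_has (fun x => (sel i x).1.1)) => [|x y]; last by rewrite sel_or.
  by rewrite has_enum z /=; apply: eq_existsb => v; rewrite tr.
- rewrite (@gather_has (fun x => (sel i x).1.2)) => [|x y]; last by rewrite sel_or.
  by rewrite has_enum z /=; apply: eq_existsb => v; rewrite tr.
- rewrite (@gather_has (fun x => (sel i x).2)) => [|x y]; last by rewrite sel_or.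
  by rewrite has_enum z /=; apply: eq_existsb => v; rewrite tr.
Qed.

Lemma tracks_next n (e : rel 'I_n) B k st : tracks e B k st ->
  tracks e B k.+1 (fun u => next_status (st u)
    (gather zero_status [seq e u v | v <- enum 'I_n] (map st (enum 'I_n)))).
Proof.
move=> tr i u; have [_ hS hT] := gather_row i u tr; have := tr i u.
rewrite /flags_of /layer iterS !inE /= -!/(layer _ _ _) -hS -hT.
by case: i {hS hT} => /= ->.
Qed.

(** With [m] sweeps already made, each further one advances the layer by one, and the last tests its
    own updated flags: layer [m + k.+1]. At least one sweep is made, so [f] is forgotten. *)
Lemma final_alarms_clash n (e : rel 'I_n) B k m st i f : tracks e B m st ->
  sel i (final_alarms k.+1 (rows_of e) (map st (enum 'I_n)) f) =
  (inner_edge e (B i), clash e (B i) (m + k.+1)).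
Proof.
elim: k m st f => [|k IH] m st f tr.
  rewrite [final_alarms _ _ _ _]/= pass_alarms_map !has_enum.
  have -> : sel i no_alarm = (false, false) by case: i.
  congr (_, _); apply: eq_existsb => u; have [h1 h2 h3] := gather_row i u tr; rewrite tr.
    by rewrite h1 /=; congr (_ && _); apply: eq_existsb => v; rewrite andbC.
  by rewrite h2 h3 addn1 /layer iterS !inE.
set xs := map st _.
have -> : final_alarms k.+2 (rows_of e) xs f =
  final_alarms k.+1 (rows_of e) (pass_status (rows_of e) xs xs)
    (pass_alarms no_alarm (rows_of e) xs xs) by [].
rewrite {2}/xs pass_status_map.
by rewrite -addSnnS; apply: IH; apply: tracks_next.
Qed.

(** * Weights, bundles and encoding of an instance *)

Lemma value_binary m : value (binary m) = m.
Proof.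
(* The first [k] digits represent [m] modulo [2 ^ k]; the length chosen in [binary] makes this power
   exceed [m]. *)
have H k : value (mkseq (fun i => odd (m %/ 2 ^ i)) k) = m %% 2 ^ k.
  elim: k m => [|k IH] m' /=; first by rewrite expn0 modn1.
  rewrite /mkseq /= -(addn0 1) iotaDl -map_comp.
  have -> : [seq (fun i => odd (m' %/ 2 ^ i)) (1 + i) | i <- iota 0 k]
     = mkseq (fun i => odd ((m' %/ 2) %/ 2 ^ i)) k.
    by apply: eq_map => i; rewrite add1n expnS divnMA.
  rewrite -/(value _) IH expn0 divn1; set q := m' %/ 2; set P := 2 ^ k.
  have E : m' = q %/ P * 2 ^ k.+1 + (odd m' + (q %% P).*2).
    rewrite {1}(divn_eq m' 2) modn2 -/q {1}(divn_eq q P) expnSr -/P; nia.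
  rewrite [RHS](_ : _ = (q %/ P * 2 ^ k.+1 + (odd m' + (q %% P).*2)) %% 2 ^ k.+1); last by rewrite -E.
  rewrite modnMDl [in RHS]modn_small //.
  have := ltn_pmod q (expn_gt0 2 k : 0 < P); rewrite expnS -/P.
  by move: (q %% P) => t; clearbody P; case: (odd m') => /=; clear; lia.
rewrite /binary H modn_small // ; exact: trunc_log_ltn.
Qed.

(** [insub] sends an index beyond the family to the default, which is how a missing bundle becomes
    empty with weight 0. *)
Lemma nth_map_ord (T : Type) (x0 : T) k (f : 'I_k -> T) i :
  nth x0 [seq f j | j <- enum 'I_k] i = oapp f x0 (insub i).
Proof.
case: insubP => [j _ <-|/negbTE hi].
  by rewrite (nth_map j) ?size_enum_ord ?(nth_ord_enum j j) ?ltn_ord.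
by rewrite nth_default // size_map size_enum_ord leqNgt hi.
Qed.

Lemma sum_ord_le2 k (F : 'I_k -> nat) : k <= 2 ->
  \sum_(j < k) F j = oapp F 0 (insub 0) + oapp F 0 (insub 1).
Proof.
have val_eq l (G : 'I_l -> nat) (x : 'I_l) i : val x = i -> oapp G 0 (insub i) = G x.
  by move=> <-; rewrite valK.
case: k F => [|[|[|//]]] F _.
- by rewrite big_ord0 !insubF.
- by rewrite big_ord1 (val_eq _ _ ord0) // insubF //= addn0.
- by rewrite big_ord_recl big_ord1 (val_eq _ _ ord0) // (val_eq _ _ (lift ord0 ord0)).
Qed.

Definition rows_I (I : instance) := rows_of (@edge I).
Definition bundles_I (I : instance) : seq (seq bool * seq bool) :=
  [seq ([seq v \in bundle j | v <- enum 'I_(nv I)], binary (weight j)) | j <- enum 'I_(nb I)].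

Definition nth_bundle (I : instance) i : {set 'I_(nv I)} := oapp (@bundle I) set0 (insub i).
Definition nth_weight (I : instance) i : nat := oapp (@weight I) 0 (insub i).

Lemma nth_bundle_weight (I : instance) i : nth_bundle I i = set0 -> nth_weight I i = 0.
Proof.
rewrite /nth_bundle /nth_weight; case: insub => //= j h.
by have := bundle_neq0 j; rewrite h eqxx.
Qed.

Lemma bundle_cost2 (I : instance) c : nb I <= 2 ->
  bundle_cost c = nth_weight I 0 * (\max_(v in nth_bundle I 0) c v) +
                  nth_weight I 1 * (\max_(v in nth_bundle I 1) c v).
Proof.
move=> h; rewrite /bundle_cost sum_ord_le2 // /nth_bundle /nth_weight.
by congr (_ + _); case: insub.
Qed.

Lemma nth_bundle_cover (I : instance) v : nb I <= 2 ->
  (v \in nth_bundle I 0) || (v \in nth_bundle I 1).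
Proof.
move=> h; have [j vj] := bundle_cover v.
have {}vj : v \in nth_bundle I (val j) by rewrite /nth_bundle valK.
have : val j < 2 by apply: leq_trans (ltn_ord j) h.
by case: (val j) vj => [|[|//]] ->; rewrite ?orbT.
Qed.

Lemma value_entry (I : instance) i : value (entry i (bundles_I I)).2 = nth_weight I i.
Proof.
by rewrite /entry nth_map_ord /nth_weight; case: insub => [j|//]; apply: value_binary.
Qed.

Lemma init_status_map (T : Type) (f g : T -> bool) s :
  init_status (map f s) (map g s) = [seq bit_status (f v) (g v) | v <- s].
Proof. by elim: s => //= v s ->. Qed.

Lemma init_status_nil (T : Type) (f : T -> bool) s :
  init_status (map f s) [::] = [seq bit_status (f v) false | v <- s].
Proof. by elim: s => //= v s ->. Qed.

Lemma init_status_I (I : instance) : nb I <= 2 ->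
  init_status (entry 0 (bundles_I I)).1 (entry 1 (bundles_I I)).1 =
  [seq bit_status (v \in nth_bundle I 0) (v \in nth_bundle I 1) | v <- enum 'I_(nv I)].
Proof.
move=> h2; rewrite /entry !nth_map_ord /nth_bundle.
case: insubP => [j0 _ _|h0].
  case: insub => [j1|] /=; first exact: init_status_map.
  by rewrite init_status_nil; apply: eq_map => v; rewrite inE.
(* Without bundles the covering condition leaves no vertices, and both sides are empty. *)
have nb0 : nb I = 0 by case: (nb I) h0.
have nv0 : nv I = 0.
  case E: (nv I) => [|k] //; have v : 'I_(nv I) by rewrite E; exact: ord0.
  by have [j _] := bundle_cover v; have := ltn_ord j; rewrite [X in _ < X]nb0.
have e0 : enum 'I_(nv I) = [::] by apply: size0nil; rewrite size_enum_ord.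
by rewrite e0.
Qed.

Lemma encode_tape (I : instance) :
  [seq sym x | x <- encode I] = input_tape (rows_I I) (bundles_I I) (binary (bound I)).
Proof.
have F s : [seq sym x | x <- field s] = row_tape s.
  by rewrite /field map_rcons -map_comp.
rewrite /encode /input_tape /rows_I /rows_of /bundles_tape /bundles_I map_cat /= map_cat /=.
rewrite !map_flatten -!map_comp cat_rcons; congr (flatten _ ++ _ :: flatten _ ++ _).
  by apply: eq_map => u /=; rewrite F.
  by apply: eq_map => j /=; rewrite map_cat !F.
by rewrite /bits -map_comp.
Qed.

Lemma trim_Some s : trim (map Some s) = map Some s.
Proof. by elim: s => //= x s ->. Qed.

Lemma trim_init (w : seq symbol) :
  trim_config (init_config machine w) =
  ((ParseM true, regs0), mk6 (word [::] [seq sym x | x <- w])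
     blank_tape blank_tape blank_tape blank_tape blank_tape).
Proof.
congr (_, _); apply/ffunP => -[[|[|[|[|[|[|//]]]]]] hi]; rewrite !ffunE //=.
rewrite /trim_tape /= /word; congr Tape; first by case: (w).
have -> : [seq inj_symbol x | x <- w] = map Some [seq sym x | x <- w] by rewrite -map_comp.
by rewrite (trim_cons _).1 trim_Some.
Qed.

Lemma size_rows_tape n rows : all (fun row => size row == n) rows ->
  size (flatten [seq row_tape s | s <- rows]) = size rows * n.+1.
Proof.
elim: rows => //= row rows IH /andP[/eqP hr /IH h].
by rewrite size_cat size_rcons size_map hr h mulSn.
Qed.

Lemma size_rows_of n (e : rel 'I_n) :
  size (rows_of e) = n /\ all (fun row => size row == n) (rows_of e).
Proof.
split; first by rewrite size_map size_enum_ord.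
by apply/allP => row /mapP[u _ ->]; rewrite size_map size_enum_ord.
Qed.

Lemma has_rows_of n (e : rel 'I_n) :
  ~~ has (has id) (rows_of e) = [forall u, forall v, ~~ e u v].
Proof.
rewrite has_map has_enum negb_exists; apply: eq_forallb => u /=.
by rewrite has_map has_enum negb_exists.
Qed.

Lemma answer_side_answer n (e : rel 'I_n) (B1 B2 : {set 'I_n}) r fit :
  let K := size (flatten [seq row_tape s | s <- rows_of e]) in
  (forall a b, a < 4 -> b < 4 -> fits r a b = fit a b) ->
  answer (has (has id) (rows_of e)) r
    (final_alarms K (rows_of e) [seq bit_status (v \in B1) (v \in B2) | v <- enum 'I_n] no_alarm)
  = side_answer e B1 B2 K fit.
Proof.
move=> K hfit; set xs := map _ _.
have H (i : bool) : sel i (final_alarms K (rows_of e) xs no_alarm) =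
    let B := if i then B2 else B1 in (inner_edge e B, clash e B K).
  have [hs ha] := size_rows_of e.
  have hK : K = n * n.+1 by rewrite /K (size_rows_tape ha) hs.
  (* No sweep is made only if there are no vertices; then alarms and graph predicates are all
     false. *)
  case E: K => [|k].
    have n0 : n = 0 by case: (n) hK E => // n' ->.
    rewrite /=; have -> : sel i no_alarm = (false, false) by case: (i).
    by congr (_, _); apply/esym/negbTE/existsPn => u; have := ltn_ord u; rewrite [X in _ < X]n0.
  apply: (@final_alarms_clash _ _ (fun i : bool => if i then B2 else B1) k 0).
  by move=> j v; rewrite /flags_of /layer /= !inE; case: (j).
rewrite /answer /side_answer has_rows_of !hfit //.
by move: (H false) (H true); rewrite /sel /= => -> ->.
Qed.

Theorem theorem12 :
  polytime_solvable_on encode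
    (fun I : instance => bipartite (@edge I) /\ nb I <= 2)
    msc_bundles.
Proof.
exists machine, (polyC 100%N * ('X + polyC 1%N) ^+ 3)%R => I [[A hA] hnb].
rewrite (_ : _.[_]%R = time_bound (size (encode I))); last first.
  rewrite hornerM horner_exp hornerD hornerX !hornerC.
  by rewrite -[(_ + 1)%R]/(_ + 1)%N addn1.
set n := nv I; set bs := bundles_I I.
have [hs ha] := size_rows_of (@edge I).
have hbs : size bs <= 2 by rewrite size_map size_enum_ord.
have hxs := init_status_I hnb.
have h0 : size (entry 0 bs).1 = n.
  by rewrite -(size_init_status _ (entry 1 bs).1) hxs size_map size_enum_ord.
have h1 : size (entry 1 bs).1 <= n.
  by rewrite /entry nth_map_ord; case: insub => [j|] //=; rewrite size_map size_enum_ord.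
have hne : all (fun p => (p.1 != [::]) && (p.2 != [::])) bs.
  apply/allP => p /mapP[j _ ->] /=; apply/andP; split.
    have [/eqP|[v _]] := set_0Vmem (bundle j); first by rewrite (negbTE (bundle_neq0 j)).
    by rewrite -size_eq0 size_map size_enum_ord -lt0n; apply: leq_ltn_trans (leq0n v) (ltn_ord v).
  by [].
have := @machine_run (rows_I I) bs (binary (bound I)) n hs ha hbs h0 h1 hne.
lazy zeta; rewrite -encode_tape size_map !value_entry value_binary hxs => -[r [rg [T [hfit [k hk hrun]]]]].
rewrite (@answer_side_answer _ _ _ _ _ (fun a b => a * nth_weight I 0 + b * nth_weight I 1 <= bound I) hfit) in hrun.
set b := side_answer _ _ _ _ _ in hrun.
exists b; split.
  rewrite /halts_within.
  rewrite -[verdict _]/(verdict_of (trim_config _).1) trim_iter trim_init.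
  (* The machine may halt early; the remaining steps up to the bound do not change the
     configuration. *)
  by rewrite -(subnK hk) iterD hrun (@iter_halt _ _ b).
apply: iff_sym; rewrite /msc_bundles.
apply: iff_trans (two_bundles _ (@edge_sym I) hA _ _ _ _).
- split=> -[c [hc h]]; exists c; split=> //; move: h; by rewrite bundle_cost2.
- by move=> v; apply: nth_bundle_cover.
- exact: nth_bundle_weight.
- exact: nth_bundle_weight.
(* There are [n * n.+1] sweeps, one per letter of the matrix with its separators, which is at least
   [2n]. *)
- rewrite (size_rows_tape ha) hs /n; case: (nv I) => // m; rewrite leq_mul2l; lia.
Qed.
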